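(* Let $n\ge1$ and let $f\le g$ be integer-valued functions on $S_{n,n}=[n]\times[n]$ ($f$ may take $-\infty$, $g$ may take $+\infty$). The following three conditions are pairwise equivalent. (A) There exists an alternating sign matrix $z$ with $f\le z\le g$. (B1) $|\mathcal I^1|+|\mathcal I^2|\ge n+\tilde f(I_2)-\tilde g(I_0)$ holds for every separated system $\mathcal I^1$ of horizontal segments and every separated system $\mathcal I^2$ of vertical segments, where $I_2$ is the set of positions covered both by a member of $\mathcal I^1$ and by a member of $\mathcal I^2$, and $I_0$ is the set of positions covered by no member of $\mathcal I^1\cup\mathcal I^2$. (B2) $\sigma_1(X')+\sigma_2(X'')\ge n+\tilde f(X'\cap X'')-\tilde g(\overline{X'}\cap\overline{X''})$ holds for every $X',X''\subseteq S_{n,n}$.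
   Context: An alternating sign matrix (ASM) is a $(0,\pm1)$-valued $n\times n$ matrix whose row and column sums are all $1$ and whose nonzero entries alternate in sign in each row and column (equivalently, all prefix sums of rows and columns are $0$ or $1$). For a function $h$ on $S_{n,n}$, $\tilde h(Z)=\sum_{s\in Z}h(s)$; $\overline Z=S_{n,n}-Z$. A horizontal segment is a set of consecutive positions $\{(i,j_1),\dots,(i,j_2)\}$ in a row; a vertical segment is a set of consecutive positions in a column. A system of horizontal segments is separated if its members are pairwise disjoint and each is a maximal horizontal segment of their union (no two are in the same row and adjacent); analogously for vertical. For $X\subseteq S_{n,n}$, $\sigma_1(X)$ (resp. $\sigma_2(X)$) is the number of inclusion-maximal horizontal (resp. vertical) segments contained in $X$. Arithmetic is in the extended integers with the usual conventions. *)

(* Defs.v *)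
From HB Require Import structures.
From mathcomp Require Import all_boot all_order all_algebra.
From mathcomp Require Import constructive_ereal.

Set Implicit Arguments.
Unset Strict Implicit.
Unset Printing Implicit Defensive.

Import Order.TTheory GRing.Theory Num.Theory.
Local Open Scope ring_scope.

Definition pos (n : nat) : finType := ('I_n * 'I_n)%type.

(* "Alternate in sign" is required of consecutive nonzero entries of a line. *)
Definition alternating (n : nat) (u : 'I_n -> int) : Prop :=
  forall j1 j2 : 'I_n, (j1 < j2)%N -> u j1 != 0 -> u j2 != 0 ->
    (forall j : 'I_n, (j1 < j < j2)%N -> u j = 0) ->
    Num.sg (u j2) = - Num.sg (u j1).

Definition is_asm (n : nat) (z : 'M[int]_n) : Prop :=
  [/\ forall i j, z i j \in [:: 0; 1; -1],
      forall i, \sum_(j < n) z i j = 1,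
      forall j, \sum_(i < n) z i j = 1,
      forall i, alternating (fun j => z i j)
    & forall j, alternating (fun i => z i j)].

Definition tilde (n : nat) (h : pos n -> \bar int) (Z : {set pos n}) : \bar int :=
  (\sum_(s in Z) h s)%E.

(* Positions are (row, column); segments are nonempty. *)
Definition hseg (n : nat) (A : {set pos n}) : bool :=
  [exists i : 'I_n, exists j1 : 'I_n, exists j2 : 'I_n,
    (j1 <= j2)%N && (A == [set s : pos n | (s.1 == i) && (j1 <= s.2 <= j2)%N])].

Definition vseg (n : nat) (A : {set pos n}) : bool :=
  [exists j : 'I_n, exists i1 : 'I_n, exists i2 : 'I_n,
    (i1 <= i2)%N && (A == [set s : pos n | (s.2 == j) && (i1 <= s.1 <= i2)%N])].

Definition max_hseg (n : nat) (X A : {set pos n}) : bool :=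
  maxset (fun B : {set pos n} => hseg B && (B \subset X)) A.

Definition max_vseg (n : nat) (X A : {set pos n}) : bool :=
  maxset (fun B : {set pos n} => vseg B && (B \subset X)) A.

Definition hseparated (n : nat) (I : {set {set pos n}}) : Prop :=
  [/\ forall A, A \in I -> hseg A,
      trivIset I
    & forall A, A \in I -> max_hseg (cover I) A].

Definition vseparated (n : nat) (I : {set {set pos n}}) : Prop :=
  [/\ forall A, A \in I -> vseg A,
      trivIset I
    & forall A, A \in I -> max_vseg (cover I) A].

Definition sigma1 (n : nat) (X : {set pos n}) : nat := #|[set A | max_hseg X A]|.
Definition sigma2 (n : nat) (X : {set pos n}) : nat := #|[set A | max_vseg X A]|.

Definition condA (n : nat) (f g : pos n -> \bar int) : Prop :=
  exists z : 'M[int]_n,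
    is_asm z /\
    forall i j : 'I_n, (f (i, j) <= (z i j)%:E)%E /\ ((z i j)%:E <= g (i, j))%E.

(* When f omits +oo and g omits -oo, the right-hand sides below never contain
   the indeterminate form oo - oo. *)
Definition condB1 (n : nat) (f g : pos n -> \bar int) : Prop :=
  forall I1 I2 : {set {set pos n}}, hseparated I1 -> vseparated I2 ->
    let both := cover I1 :&: cover I2 in
    let none := ~: cover (I1 :|: I2) in
    (((#|I1| + #|I2|)%N%:Z)%:E >= (n%:Z)%:E + tilde f both - tilde g none)%E.

Definition condB2 (n : nat) (f g : pos n -> \bar int) : Prop :=
  forall X1 X2 : {set pos n},
    (((sigma1 X1 + sigma2 X2)%N%:Z)%:E >=
       (n%:Z)%:E + tilde f (X1 :&: X2) - tilde g (~: X1 :&: ~: X2))%E.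

(* Main.v *)
Require Import Defs.
From HB Require Import structures.
From mathcomp Require Import all_boot all_order all_algebra.
From mathcomp Require Import constructive_ereal zify.

Set Implicit Arguments.
Unset Strict Implicit.
Unset Printing Implicit Defensive.

Import Order.TTheory GRing.Theory Num.Theory.
Local Open Scope ring_scope.

(** A matrix is an ASM iff its row and column sums are 1 and all partial sums of
    its rows and columns lie in [0, 1]. Taking these partial sums as flows with
    capacities [0, 1] turns ASMs between f and g into feasible integral flows of
    a network, and (B2) is Hoffman's cut condition for that network,
    because the maximal segments of a set correspond to their last positions.
    Hoffman's theorem itself is proved by tightening bounds: if an edge has
    l < u, then raising l or lowering u by one preserves the cut condition;
    otherwise the edge would leave one tight set and enter another, against
    submodularity of the cut capacity. *)

(** * Integral flows with demands: Hoffman's theorem *)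

Section Hoffman.

Variables (V E : finType) (src dst : E -> V).

(** Summed over all edges, this is the largest net inflow into [U] that the bounds allow; for
    [l = u = x] it is the net inflow of [x] itself. *)
Definition cut_term (U : {set V}) (l u : E -> int) (e : E) : int :=
  if (src e \notin U) && (dst e \in U) then u e
  else if (src e \in U) && (dst e \notin U) then - l e else 0.

Definition cut_cap (l u : E -> int) (U : {set V}) : int :=
  \sum_e cut_term U l u e.

Definition incr_at (e0 : E) (h : E -> int) (k : int) (e : E) : int :=
  if e == e0 then h e + k else h e.

(** The comparison is edge by edge. The edge [e0] joins [U] minus [W] to [W] minus [U], so neither
    the intersection nor the union sees it, while [U] and [W] together pay [u e0 - l e0] for it. *)
Lemma cut_cap_submod (l u : E -> int) (U W : {set V}) (e0 : E) :
    (forall e, l e <= u e) ->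
    src e0 \in U -> dst e0 \notin U -> src e0 \notin W -> dst e0 \in W ->
  cut_cap l u (U :&: W) + cut_cap l u (U :|: W) + (u e0 - l e0)
    <= cut_cap l u U + cut_cap l u W.
Proof.
move=> lu sU dU sW dW; rewrite /cut_cap -!big_split /= (bigD1 e0) //=.
rewrite [leRHS](bigD1 e0) //= [leLHS]addrAC; apply: lerD.
  by rewrite /cut_term !inE sU (negPf dU) (negPf sW) dW /=; lia.
apply: ler_sum => e _; rewrite /cut_term !inE; have := lu e.
by case: (src e \in U); case: (dst e \in U); case: (src e \in W);
  case: (dst e \in W) => /=; lia.
Qed.

Lemma cut_cap_incr_low (l u : E -> int) (e0 : E) (U : {set V}) :
  cut_cap (incr_at e0 l 1) u U =
  cut_cap l u U - ((src e0 \in U) && (dst e0 \notin U))%:R.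
Proof.
rewrite /cut_cap (bigD1 e0) //= [in RHS](bigD1 e0) //=.
rewrite [RHS]addrAC; congr (_ + _).
  rewrite /cut_term /incr_at eqxx.
  by case: (src e0 \in U); case: (dst e0 \in U) => /=; lia.
by apply: eq_bigr => e /negPf ne; rewrite /cut_term /incr_at ne.
Qed.

Lemma cut_cap_decr_up (l u : E -> int) (e0 : E) (U : {set V}) :
  cut_cap l (incr_at e0 u (-1)) U =
  cut_cap l u U - ((src e0 \notin U) && (dst e0 \in U))%:R.
Proof.
rewrite /cut_cap (bigD1 e0) //= [in RHS](bigD1 e0) //=.
rewrite [RHS]addrAC; congr (_ + _).
  rewrite /cut_term /incr_at eqxx.
  by case: (src e0 \in U); case: (dst e0 \in U) => /=; lia.
by apply: eq_bigr => e /negPf ne; rewrite /cut_term /incr_at ne.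
Qed.

Lemma cut_capC (x : E -> int) (U : {set V}) :
  cut_cap x x (~: U) = - cut_cap x x U.
Proof.
rewrite /cut_cap -sumrN; apply: eq_bigr => e _; rewrite /cut_term !inE.
by case: (src e \in U); case: (dst e \in U) => /=; lia.
Qed.

Lemma hoffman_circulation (b : V -> int) (l u : E -> int) :
    (forall e, l e <= u e) -> \sum_v b v = 0 ->
    (forall U : {set V}, \sum_(v in U) b v <= cut_cap l u U) ->
  exists x : E -> int, (forall e, l e <= x e <= u e) /\
    forall U : {set V}, cut_cap x x U = \sum_(v in U) b v.
Proof.
move=> lu b0; pose bsum (U : {set V}) : int := \sum_(v in U) b v.
pose gap (l u : E -> int) : int := \sum_e (u e - l e).
have gap_incr_low l' u' e0 : gap (incr_at e0 l' 1) u' = gap l' u' - 1.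
  rewrite /gap (bigD1 e0) //= [in RHS](bigD1 e0) //= /incr_at eqxx.
  rewrite [RHS]addrAC opprD addrA; congr (_ + _).
  by apply: eq_bigr => e /negPf ->.
have gap_decr_up l' u' e0 : gap l' (incr_at e0 u' (-1)) = gap l' u' - 1.
  rewrite /gap (bigD1 e0) //= [in RHS](bigD1 e0) //= /incr_at eqxx.
  rewrite [RHS]addrAC [u' e0 - 1 - _]addrAC; congr (_ + _).
  by apply: eq_bigr => e /negPf ->.
have gap_ge0 (l' u' : E -> int) : (forall e, l' e <= u' e) -> 0 <= gap l' u'.
  by move=> lu'; apply: sumr_ge0 => e _; rewrite subr_ge0.
(* The induction is on the total width of the bounds, which each tightening lowers by one. *)
have [m] := ubnP (absz (gap l u)).
rewrite -/(forall U, bsum U <= cut_cap l u U).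
elim: m l u lu => // m IH l u lu lt_m cutP.
case: (pickP (fun e => l e < u e)) => [e0 lt_e0|eq_lu]; last first.
  have eql e : u e = l e by have := eq_lu e; have := lu e; lia.
  have {}cutP U : bsum U <= cut_cap l l U.
    by rewrite (le_trans (cutP U)) // /cut_cap /cut_term;
      under eq_bigr do rewrite eql.
  (* With equal bounds, the conditions for [U] and for its complement have both sides adding up to
     0, so both are equalities. *)
  exists l; split=> [e|U]; first by rewrite eql lexx.
  rewrite -/(bsum U); have := cutP U; have := cutP (~: U); rewrite cut_capC.
  have : bsum U + bsum (~: U) = 0.
    rewrite -[RHS]b0 [RHS](bigID (mem U)) /=; congr (_ + _).
    by apply: eq_bigl => v; rewrite inE.
  lia.
have gap_lu := gap_ge0 _ _ lu.
have [/forallP lowP|/forallPn[U]] := boolP [forall U : {set V},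
    bsum U <= cut_cap (incr_at e0 l 1) u U].
  have lu' e : incr_at e0 l 1 e <= u e.
    by rewrite /incr_at; case: eqP => [->|_]; [lia | exact: lu].
  have [|x [xP xU]] := IH _ _ lu' _ lowP.
    by have := gap_ge0 _ _ lu'; rewrite gap_incr_low; lia.
  exists x; split=> // e; have := xP e; rewrite /incr_at.
  by case: eqP => [->|_]; lia.
have [/forallP upP _|/forallPn[W]] := boolP [forall U : {set V},
    bsum U <= cut_cap l (incr_at e0 u (-1)) U].
  have lu' e : l e <= incr_at e0 u (-1) e.
    by rewrite /incr_at; case: eqP => [->|_]; [lia | exact: lu].
  have [|x [xP xU]] := IH _ _ lu' _ upP.
    by have := gap_ge0 _ _ lu'; rewrite gap_decr_up; lia.
  exists x; split=> // e; have := xP e; rewrite /incr_at.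
  by case: eqP => [->|_]; lia.
(* e0 leaves the tight set U and enters the tight set W. *)
rewrite cut_cap_incr_low cut_cap_decr_up => badW badU.
have := cutP U; have := cutP W; move: badW badU.
case: (boolP (src e0 \in W)) => [|sW] /=; first by lia.
case: (boolP (dst e0 \in W)) => [dW|] /=; last by lia.
case: (boolP (src e0 \in U)) => [sU|] /=; last by lia.
case: (boolP (dst e0 \in U)) => [|dU] /=; first by lia.
have := cut_cap_submod lu sU dU sW dW.
have := cutP (U :&: W); have := cutP (U :|: W).
have : bsum (U :&: W) + bsum (U :|: W) = bsum U + bsum W.
  rewrite /bsum !(big_mkcond (fun v => v \in _)) -!big_split /=.
  apply: eq_bigr => v _; rewrite !inE.
  by case: (v \in U); case: (v \in W); rewrite /= ?addr0 ?add0r.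
lia.
Qed.

End Hoffman.

(** * Prefix sums of a single row or column *)

Section Lines.

Variable n : nat.
Implicit Types (u : 'I_n -> int) (k : nat).

Definition psum u k : int := \sum_(j < n | (j < k)%N) u j.

Lemma psum0 u : psum u 0 = 0.
Proof. by rewrite /psum big_pred0. Qed.

Lemma psum_full u : psum u n = \sum_(j < n) u j.
Proof. by apply: eq_bigl => j; rewrite ltn_ord. Qed.

Lemma psumS u (j : 'I_n) : psum u j.+1 = psum u j + u j.
Proof.
rewrite /psum (bigD1 j) ?leqnn //= addrC; congr (_ + _).
by apply: eq_bigl => i; rewrite -val_eqE /=; lia.
Qed.

(** Induction on [b] that remembers the last nonzero entry [u j]: the sum so far is 0 or [u j], and
    the next nonzero entry is [- u j], so the sum becomes that entry or 0. *)
Lemma alternating_interval_sum u (a b : nat) :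
    (forall j, u j \in [:: 0; 1; -1]) -> alternating u -> (a <= b <= n)%N ->
  (psum u b = psum u a /\ forall j : 'I_n, (a <= j < b)%N -> u j = 0) \/
  exists j : 'I_n, [/\ (a <= j < b)%N, u j != 0,
    forall i : 'I_n, (j < i < b)%N -> u i = 0 &
    psum u b - psum u a = 0 \/ psum u b - psum u a = u j].
Proof.
move=> u01 altu; elim: b => [|b IH] /andP[ab bn].
  by left; move: ab; rewrite leqn0 => /eqP ->; split=> // j; rewrite andbF.
have [a_eq|ab'] : (a = b.+1) \/ (a <= b)%N by lia.
  by left; rewrite a_eq; split=> // j; lia.
have [] := IH; first by lia.
all: rewrite -[b]/(val (Ordinal bn)); set k := Ordinal bn; rewrite psumS.
  case=> -> zer; have [uk|uk] := eqVneq (u k) 0.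
    left; rewrite uk addr0; split=> // j jP.
    have [<-//|ne] := eqVneq k j; apply: zer.
    by move: ne; rewrite -val_eqE /=; move: jP => /=; lia.
  right; exists k; split=> //=; [lia | by move=> i; lia | right; lia].
case=> j [jP uj zer sumP]; have [uk|uk] := eqVneq (u k) 0.
  right; exists j; split=> //; last by rewrite uk addr0.
    by move: jP => /=; lia.
  move=> i iP; have [<-//|ne] := eqVneq k i; apply: zer.
  by move: ne; rewrite -val_eqE /=; move: iP => /=; lia.
right; exists k; split=> //=; [lia | by move=> i; lia |].
have jk : (j < k)%N by case/andP: jP.
have := altu j k jk uj uk zer.
have := u01 j; have := u01 k; rewrite !inE.
by move=> /or3P[] /eqP uk' /or3P[] /eqP uj'; move: uk uj sumP;
  rewrite uk' uj' //= => _ _; lia.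
Qed.

(** The first [k] entries and the remaining ones each sum to at most 1 in absolute value, and the
    two sums add up to 1. *)
Lemma alternating_psum u :
    (forall j, u j \in [:: 0; 1; -1]) -> \sum_(j < n) u j = 1 ->
    alternating u ->
  forall k, (k <= n)%N -> 0 <= psum u k <= 1.
Proof.
move=> u01 u1 altu k kn.
have bnd (a b : nat) : (a <= b <= n)%N -> `|psum u b - psum u a| <= 1.
  move=> ab; have [[-> _]|[j [_ _ _]]] := alternating_interval_sum u01 altu ab.
    by rewrite subrr.
  by case=> ->; rewrite // ?normr0 //; have := u01 j; rewrite !inE;
    case/or3P => /eqP ->.
have := bnd 0%N k; have := bnd k n; rewrite psum0 psum_full u1 kn leqnn.
by move=> /(_ isT) + /(_ isT); lia.
Qed.

Lemma psum_alternating u :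
    (forall k, (k <= n)%N -> 0 <= psum u k <= 1) ->
  (forall j, u j \in [:: 0; 1; -1]) /\ alternating u.
Proof.
move=> u01.
have stp (j : 'I_n) : [/\ 0 <= psum u j <= 1, 0 <= psum u j.+1 <= 1 &
    psum u j.+1 = psum u j + u j].
  by split; [apply: u01; apply: ltnW | apply: u01 | apply: psumS].
split=> [j|j1 j2 j12 u1 u2 between].
  by case: (stp j) => ? ? ?; rewrite !inE; lia.
(* Prefix sums stay constant between the two nonzero entries, so within [0, 1] a step up can only be
   followed by a step down, and conversely. *)
have eq12 : psum u j2 = psum u j1.+1.
  rewrite /psum [LHS](bigID (fun j : 'I_n => (j < j1.+1)%N)) /=.
  rewrite [X in _ + X]big1 ?addr0; last first.
    by move=> j jP; apply: between; lia.
  by apply: eq_bigl => j; lia.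
have [? ? ?] := stp j1; have [? ? ?] := stp j2.
have : (u j1 = 1 /\ u j2 = -1) \/ (u j1 = -1 /\ u j2 = 1) by lia.
by case=> -[-> ->].
Qed.

(** The default of [insubd] makes the last index its own successor; the end of a line is therefore
    tested separately by [j.+1 == n]. *)
Definition nxt (j : 'I_n) : 'I_n := insubd j j.+1.

Lemma val_nxt (j : 'I_n) : nxt j = (if (j.+1 < n)%N then j.+1 else j) :> nat.
Proof. by rewrite /nxt val_insubd. Qed.

(** Each maximal run of consecutive indices in [D] contributes a difference of two prefix sums,
    hence at most 1, and the right side counts the last indices of the runs. *)
Lemma sum_le_ends u (D : {set 'I_n}) :
    (forall k, (k <= n)%N -> 0 <= psum u k <= 1) ->
  \sum_(j in D) u j <= \sum_(j in D) ((j.+1 == n) || (nxt j \notin D))%:R.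
Proof.
move=> u01.
pose v j : int := if j \in D then u j else 0.
pose w (j : 'I_n) : int :=
  if j \in D then ((j.+1 == n) || (nxt j \notin D))%:R else 0.
(* [psum w k] counts the runs that ended before [k]. If [k] continues a run, that run has
   contributed at most [psum u k] so far, since the prefix sum at its start is nonnegative. The
   existential also covers [k = n], where it is false. *)
have claim k : (k <= n)%N -> psum v k <= psum w k +
    (if [exists j in D, j == k :> nat] then psum u k else 0).
  elim: k => [|k IH] kn; first by rewrite !psum0; case: ifP.
  have /IH := ltnW kn; have := u01 k (ltnW kn); have := u01 _ kn.
  rewrite -[k]/(nat_of_ord (Ordinal kn)); set j := Ordinal kn.
  rewrite !psumS => ??.
  have -> : [exists i in D, i == j :> nat] = (j \in D).
    apply/exists_inP/idP => [[i iD /eqP/val_inj <-//]|jD].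
    by exists j.
  have -> : [exists i in D, i == j.+1 :> nat] =
      ((j.+1 < n)%N && (nxt j \in D)).
    apply/exists_inP/andP => [[i iD /eqP ij]|[jn jD]].
      have jn : (j.+1 < n)%N by rewrite -ij ltn_ord.
      split=> //; suff -> : nxt j = i by [].
      by apply: val_inj; rewrite /= val_nxt jn ij.
    by exists (nxt j) => //; apply/eqP; rewrite val_nxt jn.
  have -> : w j = (if j \in D then (~~ ((j.+1 < n)%N && (nxt j \in D)))%:R else 0).
    by rewrite /w negb_and -leqNgt eqn_leq ltn_ord.
  have -> : v j = (if j \in D then u j else 0) by [].
  move: (psum v j) (psum w j) => pv pw; clearbody j.
  by case: (j \in D); case: (_ && _) => /=; lia.
have := claim n (leqnn n).
rewrite (_ : [exists j in D, _] = false) ?addr0 ?psum_full; last first.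
  by apply/negbTE/exists_inPn => j _; have := ltn_ord j; lia.
by rewrite -!big_mkcond.
Qed.

End Lines.

(** * Maximal segments of a set of positions *)

Section Segments.

Variable n : nat.
Implicit Types (X A B : {set pos n}) (s : pos n).

Definition row_seg (i j1 j2 : 'I_n) : {set pos n} :=
  [set s : pos n | (s.1 == i) && (j1 <= s.2 <= j2)%N].

Lemma hsegP A :
  reflect (exists i, exists j1 : 'I_n, exists2 j2 : 'I_n,
             (j1 <= j2)%N & A = row_seg i j1 j2) (hseg A).
Proof.
apply: (iffP existsP) => [[i /existsP[j1 /existsP[j2 /andP[le /eqP ->]]]]|].
  by exists i, j1, j2.
case=> i [j1 [j2 le ->]]; exists i; apply/existsP; exists j1.
by apply/existsP; exists j2; rewrite le eqxx.
Qed.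

Lemma hseg_row_seg (i j1 j2 : 'I_n) : (j1 <= j2)%N -> hseg (row_seg i j1 j2).
Proof. by move=> le; apply/hsegP; exists i, j1, j2. Qed.

Lemma hseg1 s : hseg [set s].
Proof.
suff -> : [set s] = row_seg s.1 s.2 s.2 by apply: hseg_row_seg.
apply/setP => t; rewrite !inE -eqn_leq eq_sym val_eqE.
by rewrite [s.2 == _]eq_sym; case: s t => [? ?] [? ?].
Qed.

Lemma hsegU A B s : hseg A -> hseg B -> s \in A -> s \in B -> hseg (A :|: B).
Proof.
case/hsegP => i [j1 [j2 le ->]] /hsegP [i' [k1 [k2 le' ->]]].
rewrite !inE => /andP[/eqP <- sA] /andP[/eqP <- sB].
pose m1 := if (j1 <= k1)%N then j1 else k1.
pose m2 := if (j2 <= k2)%N then k2 else j2.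
have -> : row_seg s.1 j1 j2 :|: row_seg s.1 k1 k2 = row_seg s.1 m1 m2.
  apply/setP => t; rewrite !inE; case: eqP => //= _.
  by rewrite /m1 /m2; case: (leqP j1 k1); case: (leqP j2 k2); lia.
by apply: hseg_row_seg; rewrite /m1 /m2; case: (leqP j1 k1); case: (leqP j2 k2); lia.
Qed.

Lemma max_hsegP X A : reflect
  [/\ hseg A, A \subset X &
      forall B, hseg B -> B \subset X -> A \subset B -> B = A] (max_hseg X A).
Proof.
apply: (iffP maxsetP) => [[/andP[hA AX] maxA]|[hA AX maxA]].
  by split=> // B hB BX; apply: maxA; rewrite hB.
by split=> [|B /andP[hB BX]]; [rewrite hA | apply: maxA].
Qed.

(** The union of two overlapping segments of [X] is again a segment of [X], so maximality makes it
    equal to both. *)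
Lemma max_hseg_eq X A B s :
  max_hseg X A -> max_hseg X B -> s \in A -> s \in B -> A = B.
Proof.
move=> /max_hsegP[hA AX maxA] /max_hsegP[hB BX maxB] sA sB.
have hU := hsegU hA hB sA sB.
have UX : A :|: B \subset X by rewrite subUset AX.
by rewrite -(maxA _ hU UX (subsetUl _ _)) (maxB _ hU UX (subsetUr _ _)).
Qed.

Definition hsegs X : {set {set pos n}} := [set A | max_hseg X A].

Lemma trivIset_hsegs X : trivIset (hsegs X).
Proof.
apply/trivIsetP => A B; rewrite !inE => mA mB; apply: contraNT.
by move=> /pred0Pn[s /andP[sA sB]]; apply/eqP; apply: (max_hseg_eq mA mB sA sB).
Qed.

Lemma cover_hsegs X : cover (hsegs X) = X.
Proof.
apply/setP => s; apply/bigcupP/idP => [[A]|sX].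
  by rewrite inE => /max_hsegP[_ /subsetP AX _] /AX.
have [|A mA sA] := @maxset_exists _ (fun B => hseg B && (B \subset X)) [set s].
  by rewrite hseg1 sub1set.
by exists A; [rewrite inE | rewrite (subsetP sA) ?set11].
Qed.

Lemma partition_hsegs X : partition (hsegs X) X.
Proof.
rewrite /partition cover_hsegs eqxx trivIset_hsegs inE /=.
apply/negP => /max_hsegP[/hsegP[i [j1 [j2 le E]]] _ _].
by have /setP/(_ (i, j1)) := E; rewrite !inE eqxx leqnn le.
Qed.

Lemma hseparated_hsegs X : hseparated (hsegs X).
Proof.
split=> [A||A]; rewrite ?cover_hsegs ?inE //; last exact: trivIset_hsegs.
by case/max_hsegP.
Qed.

(** A maximal segment of the cover meets some member, which is maximal too and hence equal to it.
    Separated systems thus amount to arbitrary sets of positions. *)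
Lemma hseparatedE (I : {set {set pos n}}) : hseparated I -> I = hsegs (cover I).
Proof.
case=> _ _ maxI; apply/setP => B; rewrite inE; apply/idP/idP => [/maxI //|mB].
case/max_hsegP: (mB) => /hsegP[i [j1 [j2 le defB]]] BX _.
have sB : (i, j1) \in B by rewrite defB !inE eqxx leqnn le.
have /bigcupP[A AI sA] := subsetP BX _ sB.
by rewrite -(max_hseg_eq (maxI A AI) mB sA sB).
Qed.

Definition hend X : {set pos n} :=
  [set s in X | (s.2.+1 == n) || ((s.1, nxt s.2) \notin X)].

(** [hend X] is a transversal of the partition into maximal segments: it meets each of them in its
    last position only. *)
Lemma sigma1E X : sigma1 X = #|hend X|.
Proof.
apply/esym/(@card_transversal _ _ _ X).
rewrite /is_transversal partition_hsegs /=.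
apply/andP; split; first by apply/subsetP => s; rewrite inE => /andP[].
apply/forall_inP => A; rewrite inE.
case/max_hsegP => /hsegP[i [j1 [j2 le ->]]] /subsetP AX maxA.
apply/cards1P; exists (i, j2); apply/setP => -[i' j]; rewrite !inE /= xpair_eqE.
apply/andP/andP => [[/andP[sX ends] /andP[/eqP ii jP]]|[/eqP -> /eqP ->]].
  split; first exact/eqP.
  apply/eqP/val_inj/eqP => /=; rewrite eqn_leq (andP jP).2 /= leqNgt.
  (* A position before the end of the segment has its right neighbour in the segment, hence in
     [X]. *)
  apply/negP => lt; case/orP: ends => [/eqP jn|/negP[]].
    by have := ltn_ord j2; lia.
  apply: AX; rewrite !inE /= ii eqxx val_nxt.
  by have := ltn_ord j2; case: ifP; lia.
rewrite eqxx le leqnn; split=> //.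
rewrite AX ?inE /= ?eqxx ?leqnn ?le //=.
apply/orP; have [jn|jn] := eqVneq j2.+1 n; [by left | right].
have ltn : (j2.+1 < n)%N by have := ltn_ord j2; lia.
(* A right neighbour in [X] would extend the segment, against maximality. *)
apply/negP => nX.
have nv : nxt j2 = j2.+1 :> nat by rewrite val_nxt ltn.
have := maxA (row_seg i j1 (nxt j2)).
rewrite hseg_row_seg; last by rewrite nv; lia.
move=> /(_ isT) maxN.
suff /setP /(_ (i, nxt j2)) : row_seg i j1 (nxt j2) = row_seg i j1 j2.
  by rewrite !inE /= eqxx nv; lia.
apply: maxN; apply/subsetP => -[i0 j0]; rewrite !inE /= nv => /andP[/eqP -> ?].
  have [->//|ne] := eqVneq j0 (nxt j2).
  apply: AX; rewrite !inE eqxx /=; move: ne; rewrite -val_eqE /= nv; lia.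
by rewrite eqxx /=; lia.
Qed.

(** * Vertical segments, by transposition *)

Definition tr X : {set pos n} := [set s : pos n | (s.2, s.1) \in X].

Lemma trK : involutive tr.
Proof. by move=> X; apply/setP => -[i j]; rewrite !inE. Qed.

Lemma tr_sub X A : (tr A \subset tr X) = (A \subset X).
Proof.
apply/subsetP/subsetP => AX [i j]; last by rewrite !inE; apply: AX.
by have := AX (j, i); rewrite !inE.
Qed.

Lemma vsegE A : vseg A = hseg (tr A).
Proof.
apply: eq_existsb => j; apply: eq_existsb => i1; apply: eq_existsb => i2.
congr (_ && _); apply/eqP/eqP => [->|eqA].
  by apply/setP => s; rewrite !inE.
by rewrite -[A]trK eqA; apply/setP => s; rewrite !inE.
Qed.

Lemma max_vsegE X A : max_vseg X A = max_hseg (tr X) (tr A).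
Proof.
apply/maxsetP/max_hsegP => [[]|[hA AX maxA]].
  rewrite vsegE => /andP[hA AX] maxA; split=> // [|B hB BX AB].
    by rewrite tr_sub.
  rewrite -[B]trK; congr tr; apply: maxA; last by rewrite -tr_sub trK.
  by rewrite vsegE trK hB -tr_sub trK.
rewrite vsegE hA -tr_sub; split=> // B; rewrite vsegE => /andP[hB BX] AB.
by apply: (can_inj trK); apply: maxA; rewrite ?tr_sub.
Qed.

Definition vsegs X : {set {set pos n}} := [set A | max_vseg X A].

Lemma vsegs_hsegs X : vsegs X = tr @^-1: hsegs (tr X).
Proof. by apply/setP => A; rewrite !inE max_vsegE. Qed.

Lemma cover_tr (I : {set {set pos n}}) : cover (tr @^-1: I) = tr (cover I).
Proof.
apply/setP => s; rewrite inE; apply/bigcupP/bigcupP => -[A AI sA].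
  by exists (tr A); rewrite ?inE // in AI sA *; case: s sA.
by exists (tr A); rewrite inE ?trK.
Qed.

Lemma cover_vsegs X : cover (vsegs X) = X.
Proof. by rewrite vsegs_hsegs cover_tr cover_hsegs trK. Qed.

Lemma hseparated_tr (I : {set {set pos n}}) :
  vseparated I -> hseparated (tr @^-1: I).
Proof.
case=> segI trivI maxI; split=> [A||A]; rewrite ?inE.
- by move=> /segI; rewrite vsegE trK.
- apply/trivIsetP => A B; rewrite !inE => AI BI AB.
  apply/pred0P => s /=; apply/negP => /andP[sA sB].
  have /trivIsetP/(_ _ _ AI BI) := trivI.
  rewrite (can_eq trK) => /(_ AB)/pred0P/(_ (s.2, s.1)).
  by rewrite /= !inE /= -surjective_pairing sA sB.
- by move=> /maxI; rewrite max_vsegE trK cover_tr.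
Qed.

Lemma vseparatedE (I : {set {set pos n}}) : vseparated I -> I = vsegs (cover I).
Proof.
move=> /hseparated_tr/hseparatedE; rewrite cover_tr => eqI.
by apply/setP => A; rewrite vsegs_hsegs -eqI !inE trK.
Qed.

Lemma vseparated_vsegs X : vseparated (vsegs X).
Proof.
split=> [A||A]; rewrite ?cover_vsegs ?inE //.
  by rewrite max_vsegE vsegE => /max_hsegP[].
apply/trivIsetP => A B; rewrite !inE !max_vsegE => mA mB; apply: contraNT.
move=> /pred0Pn[s /andP[sA sB]]; apply/eqP/(can_inj trK).
by apply: (max_hseg_eq (s := (s.2, s.1)) mA mB); rewrite inE -surjective_pairing.
Qed.

Definition vend X : {set pos n} :=
  [set s in X | (s.1.+1 == n) || ((nxt s.1, s.2) \notin X)].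

Lemma sigma2E X : sigma2 X = #|vend X|.
Proof.
transitivity (sigma1 (tr X)).
  rewrite /sigma1 /sigma2 -[RHS](card_preimset _ (can_inj trK)).
  by apply: eq_card => A; rewrite !inE max_vsegE.
rewrite sigma1E -[RHS](card_preimset _ (can_inj
  (f := fun s : pos n => (s.2, s.1)) (g := fun s => (s.2, s.1)) _)).
  by apply: eq_card => A; rewrite !inE.
by case.
Qed.

(** Taking covers and taking maximal segments are inverse to each other and turn the inequality of
    one condition into that of the other. *)
Lemma condB1_condB2 (f g : pos n -> \bar int) : condB1 f g <-> condB2 f g.
Proof.
have coverU (I1 I2 : {set {set pos n}}) :
    ~: cover (I1 :|: I2) = ~: cover I1 :&: ~: cover I2.
  by rewrite /cover bigcup_setU setCU.
split=> [B1 X1 X2|B2 I1 I2 sep1 sep2] /=.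
  have := B1 _ _ (hseparated_hsegs X1) (vseparated_vsegs X2).
  by rewrite /= coverU cover_hsegs cover_vsegs.
have card1 : #|I1| = sigma1 (cover I1) by rewrite {1}(hseparatedE sep1).
have card2 : #|I2| = sigma2 (cover I2) by rewrite {1}(vseparatedE sep2).
by rewrite coverU card1 card2; apply: B2.
Qed.

End Segments.

(** * Alternating sign matrices between bounds *)

Section Grid.

Variable n : nat.
Implicit Types (X : {set pos n}) (s : pos n).

Lemma sum_rows (F : pos n -> int) X :
  \sum_(s in X) F s = \sum_i \sum_(j in [set j | (i, j) \in X]) F (i, j).
Proof.
rewrite pair_big_dep /=.
by apply: eq_big => [[i j]|[i j] _]; rewrite ?inE.
Qed.

Lemma sum_cols (F : pos n -> int) X :
  \sum_(s in X) F s = \sum_j \sum_(i in [set i | (i, j) \in X]) F (i, j).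
Proof.
rewrite sum_rows (exchange_big_dep xpredT) //=.
by apply: eq_bigr => j _; apply: eq_bigl => i; rewrite !inE.
Qed.

Lemma card_hend X : #|hend X|%:Z =
  \sum_(s in X) ((s.2.+1 == n) || ((s.1, nxt s.2) \notin X))%:R.
Proof.
rewrite -natz -sum1_card natr_sum big_mkcond [RHS]big_mkcond /=.
by apply: eq_bigr => s _; rewrite inE; case: (s \in X); case: (_ || _).
Qed.

Lemma card_vend X : #|vend X|%:Z =
  \sum_(s in X) ((s.1.+1 == n) || ((nxt s.1, s.2) \notin X))%:R.
Proof.
rewrite -natz -sum1_card natr_sum big_mkcond [RHS]big_mkcond /=.
by apply: eq_bigr => s _; rewrite inE; case: (s \in X); case: (_ || _).
Qed.

Definition row_bounded (z : 'M[int]_n) : Prop :=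
  forall i k, (k <= n)%N -> 0 <= psum (fun j => z i j) k <= 1.

Definition col_bounded (z : 'M[int]_n) : Prop :=
  forall j k, (k <= n)%N -> 0 <= psum (fun i => z i j) k <= 1.

Lemma is_asmE (z : 'M[int]_n) : is_asm z <->
  [/\ row_bounded z, col_bounded z, forall i, \sum_j z i j = 1 &
      forall j, \sum_i z i j = 1].
Proof.
split=> [[z01 row1 col1 altr altc]|[rowP colP row1 col1]].
  by split=> // [i|j]; apply: alternating_psum.
have rP i := psum_alternating (rowP i); have cP j := psum_alternating (colP j).
by split=> // [i j|i|j]; [apply: (rP i).1 | apply: (rP i).2 | apply: (cP j).2].
Qed.

(** In each row, [hend X] picks out the run ends that [sum_le_ends] counts. *)
Lemma row_bounded_sum (z : 'M[int]_n) X : row_bounded z ->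
  \sum_(s in X) z s.1 s.2 <= (sigma1 X)%:Z.
Proof.
move=> zP; rewrite sigma1E card_hend !sum_rows; apply: ler_sum => i _ /=.
apply: le_trans (sum_le_ends _ (zP i)) _; apply: ler_sum => j _.
by rewrite inE.
Qed.

Lemma col_bounded_sum (z : 'M[int]_n) X : col_bounded z ->
  \sum_(s in X) z s.1 s.2 <= (sigma2 X)%:Z.
Proof.
move=> zP; rewrite sigma2E card_vend !sum_cols; apply: ler_sum => j _ /=.
apply: le_trans (sum_le_ends _ (zP j)) _; apply: ler_sum => i _.
by rewrite inE.
Qed.

Lemma condA_condB2 (f g : pos n -> \bar int) : condA f g -> condB2 f g.
Proof.
case=> z [/is_asmE[rowP colP row1 _] zfg] X1 X2.
pose F s := z s.1 s.2.
have leF : (tilde f (X1 :&: X2) <= (\sum_(s in X1 :&: X2) F s)%:E)%E.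
  by rewrite -sumEFin; apply: lee_sum => -[i j] _; have [] := zfg i j.
have leG : ((\sum_(s in ~: X1 :&: ~: X2) F s)%:E <=
    tilde g (~: X1 :&: ~: X2))%E.
  by rewrite -sumEFin; apply: lee_sum => -[i j] _; have [] := zfg i j.
apply: le_trans (leeB (leeD (lexx _) leF) leG) _.
rewrite -EFinD lee_fin.
have total : \sum_s F s = n%:Z.
  have -> : \sum_s F s = \sum_i \sum_j z i j by rewrite pair_bigA.
  under eq_bigr do rewrite row1.
  by rewrite sumr_const card_ord natz.
have := row_bounded_sum X1 rowP; have := col_bounded_sum X2 colP.
rewrite -/(F _).
(* A position in both sets is counted twice on the left and one in neither set not at all, whereas
   [n] is the sum of all entries. *)
have : \sum_(s in X1) F s + \sum_(s in X2) F s =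
    n%:Z + \sum_(s in X1 :&: X2) F s - \sum_(s in ~: X1 :&: ~: X2) F s.
  rewrite -total !(big_mkcond (fun s => s \in _)) -sumrN -!big_split /=.
  apply: eq_bigr => s _; rewrite !inE.
  by case: (s \in X1); case: (s \in X2); rewrite /= ?subr0 ?addr0 ?add0r ?subrr.
move: (\sum_(s in X1) F s) (\sum_(s in X2) F s) (\sum_(s in X1 :&: X2) F s).
move: (\sum_(s in ~: X1 :&: ~: X2) F s) => a b c d /=; lia.
Qed.

(** * The flow network and its cuts *)

Lemma sum_last_row : (0 < n)%N -> \sum_(s : pos n) (s.1.+1 == n)%:R = n%:Z.
Proof.
move=> n_gt0.
have -> : \sum_(s : pos n) (s.1.+1 == n)%:R =
    \sum_(i < n) \sum_(j < n) (i.+1 == n)%:R :> int by rewrite pair_bigA.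
have ln : (n.-1 < n)%N by lia.
rewrite (bigD1 (Ordinal ln)) //= [X in _ + X]big1 ?addr0 => [|i ne].
  by rewrite prednK // eqxx mulr1n sumr_const card_ord natz.
apply: big1 => j _; rewrite -val_eqE /= in ne.
by rewrite (_ : _ == n = false) //; lia.
Qed.

Lemma sum_last_col : (0 < n)%N -> \sum_(s : pos n) (s.2.+1 == n)%:R = n%:Z.
Proof.
move=> /sum_last_row <-.
rewrite (reindex_inj (h := fun s : pos n => (s.2, s.1))) //.
by move=> [i j] [i' j'] [-> ->].
Qed.

(* The flow network: each position s has a node inl s on its row and a node
   inr s on its column, and z s is the flow from inl s to inr s. The flow on the
   edge entering inl s from its right neighbour is the sum of z over the row up
   to s, the flow on the edge leaving inr s downwards is the sum over the column
   up to s. Past the last column or row these edges are replaced by loops (which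
   no cut sees) and by the demand grid_demand. *)
Definition grid_src (e : pos n + (pos n + pos n)) : pos n + pos n :=
  match e with
  | inl s => inl s
  | inr (inl s) => inl (s.1, nxt s.2)
  | inr (inr s) => inr s
  end.

Definition grid_dst (e : pos n + (pos n + pos n)) : pos n + pos n :=
  match e with
  | inl s => inr s
  | inr (inl s) => inl s
  | inr (inr s) => inr (nxt s.1, s.2)
  end.

Definition grid_bound (h : pos n -> int) (k : int)
    (e : pos n + (pos n + pos n)) : int :=
  if e is inl s then h s else k.

(** Values are net inflows. In the last column no edge brings the row sum in, so the row node emits
    one unit; in the last row the column node absorbs one. This encodes that every line sums to
    1. *)
Definition grid_demand (v : pos n + pos n) : int :=
  match v with
  | inl s => - (s.2.+1 == n)%:R
  | inr s => (s.1.+1 == n)%:R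
  end.

Let capacity := cut_cap grid_src grid_dst.

Lemma nxt_last (j : 'I_n) : j.+1 = n -> nxt j = j.
Proof. by move=> jn; apply: val_inj; rewrite /= val_nxt jn ltnn. Qed.

(** The edge of [s] leaves [U] when [s] is in both sets and enters it when [s] is in neither. A row
    edge enters [U] when [s] is in [X1] and its right neighbour is not, a column edge when [s] is in
    [X2] and the position below is not: these are the ends inside the grid, with capacity 1. The
    demand supplies [n] minus the ends on the border. *)
Lemma grid_cut (f g : pos n -> int) (U : {set pos n + pos n}) : (0 < n)%N ->
  let X1 := [set s | inl s \in U] in
  let X2 := [set s | inr s \notin U] in
  \sum_(v in U) grid_demand v - capacity (grid_bound f 0) (grid_bound g 1) U =
  n%:Z + \sum_(s in X1 :&: X2) f s - \sum_(s in ~: X1 :&: ~: X2) g s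
    - #|hend X1|%:Z - #|vend X2|%:Z.
Proof.
move=> n_gt0 X1 X2; rewrite card_hend card_vend -(sum_last_row n_gt0).
rewrite /capacity /cut_cap !big_sumType /= !(big_mkcond (fun s => s \in _)) /=.
rewrite !(big_mkcond (fun s => inl s \in _)) !(big_mkcond (fun s => inr s \in _)).
rewrite -!sumrN -!big_split /= -sumrN -!big_split /=.
apply: eq_bigr => -[i j] _; rewrite /cut_term !inE /=.
have [/nxt_last ->|_] := eqVneq i.+1 n; have [/nxt_last ->|_] := eqVneq j.+1 n;
case: (inl (i, j) \in U); case: (inr (i, j) \in U) => /=; rewrite /= ?andbF /=;
  try (case: (inl (i, nxt j) \in U) => /=); try (case: (inr (nxt i, j) \in U) => /=);
  lia.
Qed.

Lemma sum_last_prefix (j : 'I_n) :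
  \sum_(k < n | (k <= j)%N) (k.+1 == n)%:R = (j.+1 == n)%:R :> int.
Proof.
rewrite (bigD1 j) //= big1 ?addr0 // => k; rewrite -val_eqE /= => kj.
by rewrite (_ : _ == n = false) //; have := ltn_ord j; lia.
Qed.

(** Flow balance over the row nodes of row [i] up to column [j]: what the position edges take out is
    brought in by the edge from the right, or by the demand in the last column. *)
Lemma grid_row_sum (x : pos n + (pos n + pos n) -> int) (i j : 'I_n) :
    (forall U, capacity x x U = \sum_(v in U) grid_demand v) ->
  psum (fun j => x (inl (i, j))) j.+1 =
  if j.+1 == n then 1 else x (inr (inl (i, j))).
Proof.
move=> xU; pose U : {set pos n + pos n} :=
  [set v : pos n + pos n | if v is inl s then (s.1 == i) && (s.2 <= j)%N else false].
have := xU U; rewrite /capacity /cut_cap !big_sumType /=.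
have -> : \sum_s cut_term grid_src grid_dst U x x (inl s) =
    - psum (fun j => x (inl (i, j))) j.+1.
  rewrite (eq_bigr (fun s : pos n =>
    if (s.1 == i) && (s.2 <= j)%N then - x (inl (s.1, s.2)) else 0)); last first.
    by move=> [i' j'] _; rewrite /cut_term !inE /= andbF andbT.
  by rewrite -big_mkcond sumrN -(pair_big (fun k : 'I_n => k == i) (fun k : 'I_n => k <= j)%N
    (fun i k => x (inl (i, k)))) /= big_pred1_eq.
have -> : \sum_s cut_term grid_src grid_dst U x x (inr (inr s)) = 0.
  by apply: big1 => s _; rewrite /cut_term !inE.
(* Only the row edge into [inl (i, j)] can cross this cut, and in the last column it is a loop. *)
have -> : \sum_s cut_term grid_src grid_dst U x x (inr (inl s)) =
    if j.+1 == n then 0 else x (inr (inl (i, j))).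
  rewrite (bigD1 (i, j)) //= big1 ?addr0 => [|[i' j'] ne].
    rewrite /cut_term !inE /= eqxx leqnn val_nxt /=.
    have [jlast|jlast] := eqVneq j.+1 n; first by rewrite jlast ltnn leqnn.
    have -> : (j.+1 < n)%N by have := ltn_ord j; lia.
    by rewrite ltnn.
  rewrite /cut_term !inE /= val_nxt; move: ne; rewrite xpair_eqE.
  case: (i' == i); rewrite ?andbF //= ?andbT -val_eqE /= => ne.
  have := ltn_ord j; have := ltn_ord j'.
  by case: (ltnP j'.+1 n) => ? ? ?; do 2?case: ifP; lia.
rewrite (eq_bigl (fun s : pos n => (s.1 == i) && (s.2 <= j)%N)) => [|s];
  last by rewrite inE.
rewrite [X in _ = _ + X]big_pred0 => [|s]; last by rewrite inE.
rewrite sumrN -(pair_big (fun k : 'I_n => k == i) (fun k : 'I_n => k <= j)%N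
  (fun _ k => (k.+1 == n)%:R)) /= big_pred1_eq sum_last_prefix.
by case: (j.+1 == n); move: (psum _ _) => a /=; lia.
Qed.

(** The same balance over column nodes, with signs reversed because the flow now enters through the
    position edges. *)
Lemma grid_col_sum (x : pos n + (pos n + pos n) -> int) (i j : 'I_n) :
    (forall U, capacity x x U = \sum_(v in U) grid_demand v) ->
  psum (fun i => x (inl (i, j))) i.+1 =
  if i.+1 == n then 1 else x (inr (inr (i, j))).
Proof.
move=> xU; pose U : {set pos n + pos n} :=
  [set v : pos n + pos n | if v is inr s then (s.1 <= i)%N && (s.2 == j) else false].
have := xU U; rewrite /capacity /cut_cap !big_sumType /=.
have -> : \sum_s cut_term grid_src grid_dst U x x (inl s) =
    psum (fun i => x (inl (i, j))) i.+1.
  rewrite (eq_bigr (fun s : pos n =>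
    if (s.1 <= i)%N && (s.2 == j) then x (inl (s.1, s.2)) else 0)); last first.
    by move=> [i' j'] _; rewrite /cut_term !inE /=.
  rewrite -big_mkcond -(pair_big (fun k : 'I_n => k <= i)%N (fun k : 'I_n => k == j)
    (fun k j => x (inl (k, j)))) /=.
  by apply: eq_bigr => k _; rewrite big_pred1_eq.
have -> : \sum_s cut_term grid_src grid_dst U x x (inr (inl s)) = 0.
  by apply: big1 => s _; rewrite /cut_term !inE.
have -> : \sum_s cut_term grid_src grid_dst U x x (inr (inr s)) =
    - if i.+1 == n then 0 else x (inr (inr (i, j))).
  rewrite (bigD1 (i, j)) //= big1 ?addr0 => [|[i' j'] ne].
    rewrite /cut_term !inE /= eqxx leqnn val_nxt /=.
    have [ilast|ilast] := eqVneq i.+1 n; first by rewrite ilast ltnn leqnn.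
    have -> : (i.+1 < n)%N by have := ltn_ord i; lia.
    by rewrite ltnn.
  rewrite /cut_term !inE /= val_nxt; move: ne; rewrite xpair_eqE.
  case: (j' == j); rewrite ?andbF //= ?andbT -val_eqE /= => ne.
  have := ltn_ord i; have := ltn_ord i'.
  by case: (ltnP i'.+1 n) => ? ? ?; do 2?case: ifP; lia.
rewrite [X in _ = X + _]big_pred0 => [|s]; last by rewrite inE.
rewrite (eq_bigl (fun s : pos n => (s.1 <= i)%N && (s.2 == j))) => [|s];
  last by rewrite inE.
rewrite -(pair_big (fun k : 'I_n => k <= i)%N (fun k : 'I_n => k == j)
  (fun k _ => (k.+1 == n)%:R)) /=.
under eq_bigr do rewrite big_pred1_eq.
rewrite sum_last_prefix.
by case: (i.+1 == n); move: (psum _ _) => a /=; lia.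
Qed.

Lemma asm_of_cuts (f g : pos n -> int) : (0 < n)%N -> (forall s, f s <= g s) ->
    (forall X1 X2, n%:Z + \sum_(s in X1 :&: X2) f s
       - \sum_(s in ~: X1 :&: ~: X2) g s <= (sigma1 X1)%:Z + (sigma2 X2)%:Z) ->
  exists z : 'M[int]_n, is_asm z /\ forall i j, f (i, j) <= z i j <= g (i, j).
Proof.
move=> n_gt0 fg cutP.
have [|||x [xP xU]] := @hoffman_circulation _ _ grid_src grid_dst
    grid_demand (grid_bound f 0) (grid_bound g 1).
- by case.
- by rewrite big_sumType /= sumrN sum_last_row // sum_last_col // addNr.
- move=> U; have := grid_cut f g U n_gt0.
  have := cutP [set s | inl s \in U] [set s | inr s \notin U].
  rewrite sigma1E sigma2E /= /capacity => le_cut cutE.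
  by rewrite -subr_le0 cutE -addrA -opprD subr_le0.
have ln : (n.-1 < n)%N by lia.
pose z : 'M[int]_n := \matrix_(i, j) x (inl (i, j)).
have rowS i (j : 'I_n) : psum (fun j => z i j) j.+1 =
    if j.+1 == n then 1 else x (inr (inl (i, j))).
  by rewrite -(grid_row_sum i j xU); apply: eq_bigr => k _; rewrite mxE.
have colS (i : 'I_n) j : psum (fun i => z i j) i.+1 =
    if i.+1 == n then 1 else x (inr (inr (i, j))).
  by rewrite -(grid_col_sum i j xU); apply: eq_bigr => k _; rewrite mxE.
exists z; split; last by move=> i j; rewrite mxE; apply: xP (inl _).
(* Nonempty proper prefix sums are flows on row or column edges, hence between 0 and 1; full ones
   equal 1 by the demand. *)
apply/is_asmE; split.
- move=> i [|k] kn; first by rewrite psum0.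
  have /= -> := rowS i (Ordinal kn); case: eqP => // _.
  exact: xP (inr (inl _)).
- move=> j [|k] kn; first by rewrite psum0.
  have /= -> := colS (Ordinal kn) j; case: eqP => // _.
  exact: xP (inr (inr _)).
- by move=> i; have := rowS i (Ordinal ln); rewrite /= prednK // eqxx psum_full.
- by move=> j; have := colS (Ordinal ln) j; rewrite /= prednK // eqxx psum_full.
Qed.

Lemma condB2_condA (f g : pos n -> \bar int) : (0 < n)%N ->
    (forall s, f s <> +oo%E) -> (forall s, g s <> -oo%E) ->
    (forall s, (f s <= g s)%E) ->
  condB2 f g -> condA f g.
Proof.
move=> n_gt0 hf hg hfg B2.
(* A bound this large makes the condition trivial for every pair of sets meeting
   an infinite value. *)
pose M : int := n%:Z + \sum_s (`|fine (f s)| + `|fine (g s)|).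
pose f' s : int := if f s is r%:E then r else - M.
pose g' s : int := if g s is r%:E then r else M.
have leM s : `|fine (f s)| <= M /\ `|fine (g s)| <= M.
  rewrite /M (bigD1 s) //=.
  have : 0 <= \sum_(t | t != s) (`|fine (f t)| + `|fine (g t)|).
    by apply: sumr_ge0 => t _; apply: addr_ge0; apply: normr_ge0.
  move: (\sum_(t | t != s) _) => a; lia.
have fg' s : f' s <= g' s.
  have := hfg s; have := hf s; have := hg s; have := leM s; rewrite /f' /g'.
  by case: (f s) => [r| |]; case: (g s) => [q| |] //=; rewrite ?lee_fin //; lia.
have [|z [asm_z zP]] := asm_of_cuts n_gt0 fg'; last first.
  (* [f'] differs from [f] only where [f] is [-oo], and [g'] from [g] only where [g] is [+oo], so
     the finite bounds imply the given ones. *)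
  exists z; split=> // i j; have := zP i j; have := hf (i, j); have := hg (i, j).
  rewrite /f' /g'; case: (f (i, j)) => [r| |]; case: (g (i, j)) => [q| |] //=;
    rewrite ?leNye ?leey ?lee_fin // => _ _ /andP[? ?]; by split.
move=> X1 X2; set P := X1 :&: X2; set Q := ~: X1 :&: ~: X2.
(* [P] and [Q] are disjoint, so [c s] is [f' s], [- g' s] or 0, and it is [- M] where an infinite
   value is met. *)
pose c s : int := (if s \in P then f' s else 0) - (if s \in Q then g' s else 0).
have sum_c : \sum_(s in P) f' s - \sum_(s in Q) g' s = \sum_s c s.
  by rewrite /c sumrB -!big_mkcond.
have le_c s : c s <= `|fine (f s)| + `|fine (g s)|.
  have := leM s; have := hf s; have := hg s; rewrite /c /f' /g' !inE.
  case: (s \in X1); case: (s \in X2); case: (f s) => [r| |];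
    case: (g s) => [q| |] //=; lia.
(* The other terms add up to at most [M - n], so one term [- M] makes the left side nonpositive. *)
have infinite_case s : c s = - M ->
    n%:Z + \sum_(s in P) f' s - \sum_(s in Q) g' s <=
    (sigma1 X1)%:Z + (sigma2 X2)%:Z.
  move=> cs; rewrite -addrA sum_c (bigD1 s) //= cs /M (bigD1 s) //=.
  have : \sum_(t | t != s) c t <=
      \sum_(t | t != s) (`|fine (f t)| + `|fine (g t)|) by apply: ler_sum.
  move: (\sum_(t | t != s) c t) => a; move: (\sum_(t | t != s) _) => b; lia.
have [/forall_inP finP|/forall_inPn[s sP infs]] :=
  boolP [forall s in P, f s \is a fin_num]; last first.
  apply: (infinite_case s); move: sP infs (hf s); rewrite /c /f' !inE.
  by case: (s \in X1); case: (s \in X2) => //=; case: (f s) => //=; lia.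
have [/forall_inP finQ|/forall_inPn[s sQ infs]] :=
  boolP [forall s in Q, g s \is a fin_num]; last first.
  apply: (infinite_case s); move: sQ infs (hg s); rewrite /c /g' !inE.
  by case: (s \in X1); case: (s \in X2) => //=; case: (g s) => //=; lia.
have := B2 X1 X2; rewrite -/P -/Q.
have -> : tilde f P = (\sum_(s in P) f' s)%:E.
  rewrite -sumEFin; apply: eq_bigr => s /finP.
  by rewrite /f'; case: (f s).
have -> : tilde g Q = (\sum_(s in Q) g' s)%:E.
  rewrite -sumEFin; apply: eq_bigr => s /finQ.
  by rewrite /g'; case: (g s).
by rewrite -EFinD lee_fin.
Qed.

End Grid.

Theorem theorem6p1 (n : nat) (f g : pos n -> \bar int)
    (hn : (1 <= n)%N)
    (hf : forall s, f s <> +oo%E)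
    (hg : forall s, g s <> -oo%E)
    (hfg : forall s, (f s <= g s)%E) :
  (condA f g <-> condB1 f g) /\
  (condA f g <-> condB2 f g) /\
  (condB1 f g <-> condB2 f g).
Proof.
have AB2 : condA f g <-> condB2 f g.
  by split; [apply: condA_condB2 | apply: condB2_condA].
have B12 := condB1_condB2 f g.
by split; [apply: iff_trans AB2 (iff_sym B12) | split].
Qed.
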